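(* Let $(X,\mathcal{S},\mu)$ be a metrizable space with a complete perfect measure. Let $Y$ be a complete metric space. If $F\colon X\to Cl^+(Y)$ is lower semi-continuous, then $F$ admits an $\mathcal{S}$-measurable selector.
   Context: $(X,\mathcal{S},\mu)$ denotes a space $X$ together with a $\sigma$-field $\mathcal{S}$ of subsets of $X$ and a measure $\mu$ defined on $\mathcal{S}$; all measures are $\sigma$-additive and finite. The sets in $\mathcal{S}$ are called measurable. A function $f\colon X\to Y$ into a topological space $Y$ is $\mathcal{S}$-measurable iff $f^{-1}(U)\in\mathcal{S}$ for each open $U\subset Y$. The measure $\mu$ is perfect iff for every $\mathcal{S}$-measurable function $f\colon X\to\mathbb{R}$ and every $E\subset\mathbb{R}$ with $f^{-1}(E)\in\mathcal{S}$ there exists a Borel set $B\subset E$ such that $\mu(f^{-1}(E))=\mu(f^{-1}(B))$. $Cl^+(Y)$ denotes the family of all non-empty closed subsets of $Y$. A map $F\colon X\to\mathcal{P}(Y)$ is lower semi-continuous iff $\{x\in X\colon F(x)\cap U\neq\emptyset\}$ is open in $X$ for each open $U\subset Y$. A selector for $F$ is a function $f\colon X\to Y$ such that $f(x)\in F(x)$ for each $x\in X$.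
   Formalization: The σ-field S is additionally assumed to contain all open subsets of X; without this the claim fails (two-point discrete X, S = {∅, X}, F(x) = {x}). *)

(* Defs.v *)
From HB Require Import structures.
From mathcomp Require Import all_boot all_order all_algebra.
From mathcomp Require Import all_classical all_reals all_analysis.

Set Implicit Arguments.
Unset Strict Implicit.
Unset Printing Implicit Defensive.

Import Order.TTheory GRing.Theory Num.Theory.
Import numFieldNormedType.Exports.

Local Open Scope classical_set_scope.
Local Open Scope ring_scope.

(* A topology and a sigma-algebra on the same carrier, a priori unrelated. *)
#[short(type="topMeasurableType")]
HB.structure Definition TopMeasurable (d : measure_display) :=
  { T of Topological T & Measurable d T }.

#[short(type="completeMetricType")]
HB.structure Definition CompleteMetric (R : numDomainType) :=
  { T of Complete T & Metric R T }.

Definition metrizable (R : realType) (T : topologicalType) : Prop :=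
  exists dist : T -> T -> R,
    [/\ forall x y, dist x y = 0 <-> x = y,
        forall x y, dist x y = dist y x,
        forall x y z, dist x z <= dist x y + dist y z &
        forall (x : T) (A : set T),
          nbhs x A <-> exists2 e : R, 0 < e & [set y | dist x y < e] `<=` A].

(* Measurability for a map into an arbitrary topological space: the target
   carries no sigma-algebra of its own, so [measurable_fun] does not apply. *)
Definition open_measurable_fun (d : measure_display) (X : measurableType d)
    (Y : topologicalType) (f : X -> Y) : Prop :=
  forall U : set Y, open U -> measurable (f @^-1` U).

Definition borel (T : topologicalType) : set (set T) := <<s @open T>>.

Definition perfect_measure (d : measure_display) (X : measurableType d)
    (R : realType) (mu : {measure set X -> \bar R}) : Prop :=
  forall f : X -> R, open_measurable_fun f ->
  forall E : set R, measurable (f @^-1` E) ->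
  exists B : set R,
    [/\ borel B, B `<=` E & mu (f @^-1` E) = mu (f @^-1` B)].

Definition nonempty_closed (Y : topologicalType) : set (set Y) :=
  [set A | closed A /\ A !=set0].

Definition lower_semicontinuous_map (X Y : topologicalType)
    (F : X -> set Y) : Prop :=
  forall U : set Y, open U -> open [set x | F x `&` U !=set0].

Definition selector (X Y : Type) (F : X -> set Y) (f : X -> Y) : Prop :=
  forall x, F x (f x).

(* Main.v *)
Require Import Defs.
From HB Require Import structures.
From mathcomp Require Import all_boot all_order all_algebra.
From mathcomp Require Import all_classical all_reals all_analysis.
From mathcomp Require wochoice.
From mathcomp Require Import ring.

Set Implicit Arguments.
Unset Strict Implicit.
Unset Printing Implicit Defensive.

Import Order.TTheory GRing.Theory Num.Theory.
Import numFieldNormedType.Exports.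

Local Open Scope classical_set_scope.
Local Open Scope ring_scope.

(** A lower semi-continuous map with non-empty closed values, from a metrizable
    space to a complete metric space, has a selector for which the inverse image
    of each open set is a countable union of closed sets; it is therefore
    measurable for every sigma-algebra that contains the open sets.

    The selector is a uniform limit of functions [f_k] such that [F x] meets
    both the ball of radius [2^-k] around [f_k x] and, at a common point, the
    ball of radius [2^-(k+1)] around [f_(k+1) x].  As [Y] need not be separable,
    [f_(k+1)] has to choose a center among uncountably many, and the difficulty is
    to keep arbitrary unions of level sets measurable.

    This is achieved by choosing the least center for a well-ordering of [Y].
    The resulting functions are sigma-locally constant ([sigma_constant]): the
    space is the increasing union of closed sets [K n] such that two points of
    [K n] at distance less than [1/(n+1)] have the same image.  The inverse image
    of any set whatsoever is then a countable union of closed sets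
    ([measurable_preimage_sigma_constant]), and the property passes from [f_k]
    to [f_(k+1)] ([sigma_constant_refine]): on the points [x] whose
    [1/(n+1)]-ball lies in the open set of points for which the center chosen at
    [x] is admissible, two close points are each admissible for the choice of
    the other, so that by minimality the two choices agree. *)

(** [dist] is a distance that induces the topology of [T]. *)
Definition metrizes (R : realType) (T : topologicalType)
    (dist : T -> T -> R) : Prop :=
  [/\ forall x y, dist x y = 0 <-> x = y,
      forall x y, dist x y = dist y x,
      forall x y z, dist x z <= dist x y + dist y z &
      forall (x : T) (A : set T),
        nbhs x A <-> exists2 e : R, 0 < e & [set y | dist x y < e] `<=` A].

Lemma metrizes_nbhs (R : realType) (T : topologicalType) (dist : T -> T -> R)
    (x : T) (e : R) :
  metrizes dist -> 0 < e -> nbhs x [set y | dist x y < e].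
Proof. by move=> [_ _ _ distE] e0; apply/distE; exists e. Qed.

Lemma exists_natSinv_lt (R : realType) (e : R) :
  0 < e -> exists n : nat, n.+1%:R^-1 < e.
Proof.
move=> e0; have [N _ Ne] := near_infty_natSinv_lt (PosNum e0).
by exists N; exact: Ne (leqnn N).
Qed.

Lemma exists_half_expn_lt (R : realType) (e : R) :
  0 < e -> exists n : nat, 2^-1 ^+ n < e.
Proof.
move=> e0; have [N _ Ne] := near_infty_natSinv_expn_lt (PosNum e0).
by exists N; have := Ne N (leqnn N); rewrite mul1r exprVn.
Qed.

Lemma exists_least_order (J : eqType) : exists r : rel J,
  antisymmetric r /\
  forall P : J -> Prop, (exists j, P j) ->
    exists j, P j /\ forall j', P j' -> r j j'.
Proof.
have [r r_wo] := wochoice.well_ordering_principle J; exists r; split.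
  by move=> x y; apply: (wochoice.wo_chain_antisymmetric
    (C := predT) (wochoice.withinW r_wo)).
move=> P [j Pj]; have [|k [[Pk k_min] _]] := r_wo [pred i | `[< P i >]].
  by exists j; apply/asboolP.
by exists k; split=> [|j' Pj']; [exact/asboolP | apply: k_min; exact/asboolP].
Qed.

(** [g] is sigma-locally constant: the space is an increasing union of closed
    sets on each of which [g] is constant at a uniform scale.  The scale is tied
    to the index and the union is increasing, so that two such decompositions
    have a common refinement indexed by [nat]: their intersection index by
    index. *)
Definition sigma_constant (R : realType) (T : topologicalType) (I : Type)
    (dist : T -> T -> R) (g : T -> I) : Prop :=
  exists K : nat -> set T,
    [/\ forall n, closed (K n),
        forall m n, (m <= n)%N -> K m `<=` K n,
        forall x, exists n, K n x &
        forall n x y, K n x -> K n y -> dist x y < n.+1%:R^-1 -> g x = g y].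

Lemma sigma_constant_cst (R : realType) (T : topologicalType) (I : Type)
    (dist : T -> T -> R) (i : I) : sigma_constant dist (fun=> i).
Proof. by exists (fun=> setT); split=> // x; exists 0%N. Qed.

Lemma measurable_preimage_sigma_constant (R : realType) (d : measure_display)
    (X : topMeasurableType d) (I : Type) (dist : X -> X -> R) (g : X -> I) :
  metrizes dist -> (forall U : set X, open U -> measurable U) ->
  sigma_constant dist g -> forall A : set I, measurable (g @^-1` A).
Proof.
move=> dist_top X_borel [K [Kcl _ Kcov Kg]] A.
have -> : g @^-1` A = \bigcup_n (K n `&` g @^-1` A).
  apply/seteqP; split=> x /= => [Agx|[n _ []]//].
  by have [n Knx] := Kcov x; exists n.
apply: bigcupT_measurable => n; rewrite -[X in measurable X]setCK.
apply: measurableC; apply: X_borel; apply: closed_openC => z zKA.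
have Knz : K n z by apply: Kcl => B /zKA[x [[Knx _] Bx]]; exists x.
have n_gt0 : 0 < n.+1%:R^-1 :> R by rewrite invr_gt0.
have [x [[Knx Agx] /= zx]] := zKA _ (metrizes_nbhs z dist_top n_gt0).
by split=> //=; rewrite (Kg _ _ _ Knz Knx zx).
Qed.

(** Given, for each value [i], open sets [G i j] indexed by [j], a sigma-locally
    constant [g] such that each [x] lies in some [G (g x) j] leads to a
    sigma-locally constant choice [h] of [j]. *)
Lemma sigma_constant_refine (R : realType) (T : topologicalType) (I : Type)
    (J : eqType) (dist : T -> T -> R) (g : T -> I) (G : I -> J -> set T) :
  metrizes dist -> sigma_constant dist g -> (forall i j, open (G i j)) ->
  (forall x, exists j, G (g x) j x) ->
  exists h : T -> J, sigma_constant dist h /\ forall x, G (g x) (h x) x.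
Proof.
move=> dist_top [K [Kcl Kmono Kcov Kg]] Gopen Gcov.
have [distxx dist_sym dist_tri distE] := dist_top.
have [r [r_anti r_least]] := exists_least_order J.
have /choice[h hP] : forall x, exists j,
    G (g x) j x /\ forall j', G (g x) j' x -> r j j'.
  by move=> x; apply: r_least (Gcov x).
exists h; split=> [|x]; last by have [] := hP x.
have n_gt0 n : 0 < n.+1%:R^-1 :> R by rewrite invr_gt0.
pose L n := [set x | forall y, dist x y < n.+1%:R^-1 -> G (g x) (h x) y].
exists (fun n => K n `&` L n); split.
- move=> n z zKL.
  have Knz : K n z by apply: Kcl => B /zKL[x [[Knx _] Bx]]; exists x.
  (* A point of the set close enough to [z] makes the same choice as [z]. *)
  have near_z e : 0 < e -> exists x,
      [/\ L n x, dist z x < e, g x = g z & h x = h z].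
    move=> e0; have [Gz hz_min] := hP z.
    have [|x [[Knx Lnx] [/= [zx_e zx_n] Gx]]] := zKL (([set y | dist z y < e] `&`
        [set y | dist z y < n.+1%:R^-1]) `&` G (g z) (h z)).
      apply: filterI; last exact: open_nbhs_nbhs.
      by apply: filterI; apply: metrizes_nbhs.
    have gxz : g x = g z by rewrite (Kg _ _ _ Knz Knx zx_n).
    exists x; split=> //; apply: r_anti; apply/andP; split.
      by have [_] := hP x; apply; rewrite gxz.
    by apply: hz_min; rewrite -gxz; apply: Lnx; rewrite dist_sym.
  split=> // y zy; have [|x [Lnx zx <- <-]] := near_z (n.+1%:R^-1 - dist z y).
    by rewrite subr_gt0.
  apply: Lnx; apply: le_lt_trans (dist_tri _ z _) _.
  by rewrite dist_sym -ltrBrDr.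
- move=> m n le_mn x [Kmx Lmx]; split; first exact: Kmono Kmx.
  move=> y xy; apply: Lmx; apply: lt_le_trans xy _.
  by rewrite lef_pV2 ?posrE// ler_nat.
- move=> x; have [m Kmx] := Kcov x; have [Gx _] := hP x.
  have /distE[e e0 eG] : nbhs x (G (g x) (h x)) by exact: open_nbhs_nbhs.
  have [n ne] := exists_natSinv_lt e0.
  exists (maxn m n); split; first exact: Kmono (leq_maxl _ _) _ Kmx.
  move=> y xy; apply: eG => /=; apply: lt_trans ne; apply: lt_le_trans xy _.
  by rewrite lef_pV2 ?posrE// ler_nat ltnS leq_maxr.
- move=> n x y [Knx Lnx] [Kny Lny] xy; have gxy := Kg _ _ _ Knx Kny xy.
  apply: r_anti; apply/andP; split.
    by have [_] := hP x; apply; rewrite gxy; apply: Lny; rewrite dist_sym.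
  by have [_] := hP y; apply; rewrite -gxy; apply: Lnx.
Qed.

(** Unlike for a pointwise limit, no distance to closed sets is needed: [f x]
    lies in [U] exactly when, for some [k], the ball of radius [s k] around
    [f_ k x] is included in [U]. *)
Lemma open_measurable_fun_uniform_limit (R : realType) (d : measure_display)
    (X : measurableType d) (Y : pseudoMetricType R)
    (f_ : nat -> X -> Y) (s : nat -> R) (f : X -> Y) :
  (forall k (A : set Y), measurable (f_ k @^-1` A)) ->
  (forall e : R, 0 < e -> exists k, s k < e) ->
  (forall k x, ball (f_ k x) (s k) (f x)) ->
  open_measurable_fun f.
Proof.
move=> f_meas s_small f_f U Uopen.
have -> : f @^-1` U = \bigcup_k f_ k @^-1` [set y | ball y (s k) `<=` U].
  apply/seteqP; split=> x /= => [Ufx|[k _ /= +]]; last by apply.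
  have /nbhs_ballP[e /= e0 eU] : nbhs (f x) U by exact: open_nbhs_nbhs.
  have [k ke] := s_small (e / 2) (divr_gt0 e0 (ltr0Sn R 1)).
  exists k => //= y ky; apply: eU; rewrite [e]splitr.
  by apply: (ball_triangle (y := f_ k x)); [apply/ball_sym|];
    apply: (le_ball (ltW ke)).
exact: bigcupT_measurable.
Qed.

(** Each step applies [sigma_constant_refine] with [Y] itself as the set of
    centers: a point of [F x] may serve as its own center.  The proof works with
    the interiors of the balls, so that lower semi-continuity makes the set of
    points at which a given center is admissible open. *)
Lemma approximate_selectors (R : realType) (X : topologicalType)
    (Y : pseudoPMetricType R) (dist : X -> X -> R) (F : X -> set Y) :
  metrizes dist -> (forall x, F x !=set0) -> lower_semicontinuous_map F ->
  exists f_ : nat -> X -> Y,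
    (forall k, sigma_constant dist (f_ k)) /\
    forall k x, exists z, [/\ F x z, ball (f_ k x) (2^-1 ^+ k) z &
                              ball (f_ k.+1 x) (2^-1 ^+ k.+1) z].
Proof.
move=> dist_top F_ne F_lsc; set r : nat -> R := fun k => 2^-1 ^+ k.
have r_gt0 k : 0 < r k by rewrite exprn_gt0// invr_gt0.
have ball_int y k : (ball y (r k))^° y by exact: nbhsx_ballx.
pose approx k (g : X -> Y) :=
  sigma_constant dist g /\ forall x, F x `&` (ball (g x) (r k))^° !=set0.
have [f0 f0P] : exists g, approx 0%N g.
  have [||g [g_sc gP]] := sigma_constant_refine (J := Y)
      (G := fun (_ : unit) y => [set x | F x `&` (ball y (r 0%N))^° !=set0])
      dist_top (sigma_constant_cst dist tt).
  - by move=> _ y; apply: F_lsc; exact: open_interior.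
  - by move=> x; have [z Fz] := F_ne x; exists z, z.
  - by exists g.
have /choice[next nextP] : forall kg : nat * (X -> Y), exists h,
    approx kg.1 kg.2 -> approx kg.1.+1 h /\
    forall x, F x `&` ((ball (kg.2 x) (r kg.1))^° `&`
                       (ball (h x) (r kg.1.+1))^°) !=set0.
  move=> [k g] /=; have [[g_sc gP]|] := pselect (approx k g); last by exists g.
  have [||h [h_sc hP]] := sigma_constant_refine (J := Y)
      (G := fun y y' => [set x | F x `&` ((ball y (r k))^° `&`
                                          (ball y' (r k.+1))^°) !=set0])
      dist_top g_sc.
  - by move=> y y'; apply: F_lsc; apply: openI; exact: open_interior.
  - by move=> x; have [z [Fz gz]] := gP x; exists z, z.
  - exists h => _; split; last exact: hP.
    by split=> // x; have [z [Fz [_ hz]]] := hP x; exists z.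
pose f_ := fix f_ k := if k is k'.+1 then next (k', f_ k') else f0.
have f_P k : approx k (f_ k).
  by elim: k => //= k IHk; have [] := nextP (k, f_ k) IHk.
exists f_; split=> [k|k x]; first by have [] := f_P k.
have [_ /(_ x)[z [Fz [fz fz']]]] := nextP (k, f_ k) (f_P k).
by exists z; split=> //; exact: interior_subset.
Qed.

Lemma summable_ball_limit (R : realType) (Y : completePseudoMetricType R)
    (y_ : nat -> Y) :
  (forall k, ball (y_ k) (2^-1 ^+ k + 2^-1 ^+ k.+1) (y_ k.+1)) ->
  exists y, forall k, ball (y_ k) (4 * 2^-1 ^+ k) y.
Proof.
set r : nat -> R := fun k => 2^-1 ^+ k => y_step.
have r_gt0 k : 0 < r k by rewrite exprn_gt0// invr_gt0.
have rS k : r k = 2 * r k.+1 by rewrite /r exprS mulrA divff// mul1r.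
have y_tail k n : ball (y_ k) (3 * r k) (y_ (k + n)%N).
  elim: n k => [|n IHn] k.
    by rewrite addn0; apply: ballxx; rewrite mulr_gt0.
  (* The step costs [3 * r k.+1], as does the remaining tail. *)
  have -> : 3 * r k = (r k + r k.+1) + 3 * r k.+1 by rewrite (rS k); ring.
  by rewrite -addSnnS; apply: ball_triangle (y_step k) (IHn _).
have [y yP] : exists y : Y, y_ @ \oo --> y.
  apply/cvg_ex; apply: cauchy_cvg; apply: cauchy_exP => e e0.
  have [k ke] := exists_half_expn_lt (divr_gt0 e0 (ltr0Sn R 2)).
  exists (y_ k); exists k => // m /= km; rewrite -(subnKC km).
  apply: le_ball (y_tail _ _); rewrite mulrC -ler_pdivlMr//; exact: ltW.
exists y => k; have [N _ Ny] := cvg_ball yP (r_gt0 k).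
have -> : 4 * 2^-1 ^+ k = 3 * r k + r k by rewrite /r; ring.
apply: (ball_triangle (y_tail k N)); apply: ball_sym.
by apply: Ny => /=; exact: leq_addl.
Qed.

Theorem theorem3 (R : realType) (d : measure_display)
    (X : topMeasurableType d) (mu : {finite_measure set X -> \bar R})
    (X_metrizable : metrizable R X)
    (X_borel : forall U : set X, open U -> measurable U)
    (mu_complete : measure_is_complete mu)
    (mu_perfect : perfect_measure mu)
    (Y : completeMetricType R)
    (F : X -> set Y)
    (F_closed : forall x, nonempty_closed (F x))
    (F_lsc : lower_semicontinuous_map F) :
  exists f : X -> Y, selector F f /\ open_measurable_fun f.
Proof.
have [dist dist_top] := X_metrizable.
have [f_ [f_sc f_P]] := approximate_selectors dist_top
  (fun x => (F_closed x).2) F_lsc.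
have half_gt0 k : 0 < 2^-1 ^+ k :> R by rewrite exprn_gt0// invr_gt0.
have /choice[f f_f] : forall x, exists y, forall k,
    ball (f_ k x) (4 * 2^-1 ^+ k) y.
  move=> x; apply: summable_ball_limit => k; have [z [_ fz fz']] := f_P k x.
  exact: ball_triangle fz (ball_sym fz').
exists f; split=> [x|]; last first.
  apply: (@open_measurable_fun_uniform_limit R _ _ _ f_
    (fun k => 4 * 2^-1 ^+ k)) => [k A|e e0|k x]; last exact: f_f.
    exact: measurable_preimage_sigma_constant (f_sc k) A.
  have [k ke] := exists_half_expn_lt (divr_gt0 e0 (ltr0Sn R 3)).
  by exists k; rewrite mulrC -ltr_pdivlMr.
have [Fcl _] := F_closed x; apply: Fcl => B /nbhs_ballP[e /= e0 eB].
have [k ke] := exists_half_expn_lt (divr_gt0 e0 (ltr0Sn R 4)).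
have [z [Fz fz _]] := f_P k x; exists z; split=> //; apply: eB.
have /le_ball : 4 * 2^-1 ^+ k + 2^-1 ^+ k <= e.
  have := ltW ke; rewrite ler_pdivlMr//; congr (_ <= _); ring.
by apply; exact: ball_triangle (ball_sym (f_f x k)) fz.
Qed.
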